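(* Let $n \geq 1$ and let $A(t) = (A_{ij}(t)) \in \operatorname{GL}(n, \mathbb{C}((t)))$ be an invertible $n \times n$ matrix whose entries are formal Laurent series in $t$ over $\mathbb{C}$. Assume that $A(t)$ is convergent in a punctured neighborhood of the origin, that is, there exists $\epsilon > 0$ such that all the Laurent series $A_{ij}(t)$ converge for every $t$ with $0 < |t| < \epsilon$. For sufficiently small $t \neq 0$, let $d_1(t) \leq \cdots \leq d_n(t)$ denote the singular values of the complex matrix $A(t)$, ordered increasingly. Let $v_1 \geq \cdots \geq v_n$ be the invariant factors of $A(t)$ (integers), ordered decreasingly. Then $$\lim_{t \to 0^+} \bigl(\log_t(d_1(t)), \ldots, \log_t(d_n(t))\bigr) = (v_1, \ldots, v_n).$$
   Context: $\mathbb{C}[[t]]$ is the ring of formal power series in $t$ over $\mathbb{C}$ and $\mathbb{C}((t))$ is its field of fractions, the field of formal Laurent series $\sum_{i \geq -k} c_i t^i$ ($k \in \mathbb{Z}$, $c_i \in \mathbb{C}$). Singular values: for a complex $n \times n$ matrix $B$, the singular values of $B$ are the square roots of the eigenvalues (counted with multiplicity) of the positive semi-definite Hermitian matrix $BB^*$, where $B^* = \bar{B}^T$ is the conjugate transpose. Invariant factors: by the Smith normal form theorem over the principal ideal domain $\mathbb{C}[[t]]$, every $A(t) \in \operatorname{GL}(n, \mathbb{C}((t)))$ can be written as $A(t) = P(t)\,\tau(t)\,Q(t)$ with $P(t), Q(t) \in \operatorname{GL}(n, \mathbb{C}[[t]])$ and $\tau(t) = \operatorname{diag}(t^{v_1},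 \ldots, t^{v_n})$ with integers $v_1 \geq \cdots \geq v_n$, and these integers are uniquely determined by $A(t)$. The integers $v_1, \ldots, v_n$ are called the invariant factors of $A(t)$. For real $t$ with $0 < t < 1$ and real $x > 0$, $\log_t(x) = \log(x)/\log(t)$ is the logarithm to the base $t$. The limit is taken over real $t > 0$ tending to $0$. *)

(* Defs.v *)
From HB Require Import structures.
From mathcomp Require Import all_boot all_order all_algebra.
From mathcomp Require Import all_classical all_reals all_analysis.
From mathcomp Require Import complex zify ring.

Set Implicit Arguments.
Unset Strict Implicit.
Unset Printing Implicit Defensive.

Import Order.TTheory GRing.Theory Num.Theory.
Import numFieldNormedType.Exports.

Local Open Scope classical_set_scope.
Local Open Scope ring_scope.

Definition vanishes_below (K : nmodType) (m : int) (c : int -> K) :=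
  forall i : int, i < m -> c i = 0.

(* [laurent K] is K((t)): [f i] is the coefficient of t^i in [f]. *)
Record laurent (K : nmodType) := Laurent {
  lcoef :> int -> K;
  laurentP : exists m : int, vanishes_below m lcoef }.

HB.instance Definition _ (K : nmodType) := gen_eqMixin (laurent K).
HB.instance Definition _ (K : nmodType) := gen_choiceMixin (laurent K).

Lemma lcoef_inj (K : nmodType) (f g : laurent K) : lcoef f =1 lcoef g -> f = g.
Proof.
case: f g => [c cP] [d dP] /= /funext cd; case: _ / cd in dP *.
by congr Laurent; exact: Prop_irrelevance.
Qed.

Section LaurentField.
Variable K : fieldType.
Implicit Types f g h : laurent K.

Lemma common_lbound f g :
  exists m : int, vanishes_below m f /\ vanishes_below m g.
Proof.
have [[m fm] [p gp]] := (laurentP f, laurentP g).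
exists (Num.min m p); split=> i; rewrite lt_min => /andP[im ip];
  [exact: fm|exact: gp].
Qed.

Fact laurent_zero_subproof : exists m : int, vanishes_below m (fun=> 0 : K).
Proof. by exists 0. Qed.
Definition laurent_zero := Laurent laurent_zero_subproof.

Fact laurent_opp_subproof f : exists m : int, vanishes_below m (fun i => - f i).
Proof. by have [m fm] := laurentP f; exists m => i /fm ->; rewrite oppr0. Qed.
Definition laurent_opp f := Laurent (laurent_opp_subproof f).

Fact laurent_add_subproof f g : exists m : int, vanishes_below m (fun i => f i + g i).
Proof.
have [m [fm gm]] := common_lbound f g.
by exists m => i im; rewrite fm// gm// addr0.
Qed.
Definition laurent_add f g := Laurent (laurent_add_subproof f g).

Fact laurent_addA : associative laurent_add.
Proof. by move=> f g h; apply: lcoef_inj => i /=; rewrite addrA. Qed.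
Fact laurent_addC : commutative laurent_add.
Proof. by move=> f g; apply: lcoef_inj => i /=; rewrite addrC. Qed.
Fact laurent_add0 : left_id laurent_zero laurent_add.
Proof. by move=> f; apply: lcoef_inj => i /=; rewrite add0r. Qed.
Fact laurent_addN : left_inverse laurent_zero laurent_opp laurent_add.
Proof. by move=> f; apply: lcoef_inj => i /=; rewrite addNr. Qed.

HB.instance Definition _ := GRing.isZmodule.Build (laurent K)
  laurent_addA laurent_addC laurent_add0 laurent_addN.

(* The sum has finite support, since both factors vanish below some index. *)
Definition convol (c d : int -> K) (i : int) : K :=
  \sum_(j \in [set: int]) c j * d (i - j).

Lemma convol_below (m p : int) (c d : int -> K) :
  vanishes_below m c -> vanishes_below p d -> vanishes_below (m + p) (convol c d).
Proof.
move=> cm dp i imp; apply: fsbig1 => j _.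
have [/cm ->|mj] := ltP j m; first by rewrite mul0r.
by rewrite dp ?mulr0//; lia.
Qed.

Lemma convolE (m p : int) (c d : int -> K) (n : nat) :
  vanishes_below m c -> vanishes_below p d ->
  convol c d (m + p + n%:Z) =
    \sum_(j < n.+1) c (m + j%:Z) * d (p + (n - j)%N%:Z).
Proof.
move=> cm dp; rewrite /convol.
rewrite (fsbigE [seq m + j%:Z | j <- iota 0 n.+1])//=; last first.
- move=> j _ jn; have [/cm ->|mj] := ltP j m; first by rewrite mul0r.
  rewrite dp ?mulr0//; rewrite ltNge; apply: contra jn => pj.
  change (j \in [seq m + k%:Z | k <- iota 0 n.+1]).
  apply/mapP; exists `|j - m|%N; last by lia.
  by rewrite mem_iota; lia.
- change (uniq [seq m + k%:Z | k <- iota 0 n.+1]).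
  by rewrite map_inj_uniq ?iota_uniq// => a b /addrI[].
rewrite -[m + 0%:Z :: _]/[seq m + k%:Z | k <- iota 0 n.+1].
rewrite big_map -[iota 0 n.+1]/(index_iota 0 n.+1) big_mkord.
apply: eq_big => [j|[j jn] _ /=]; first by rewrite in_setT.
by congr (_ * d _); lia.
Qed.

Let trunc (m : int) (n : nat) (c : int -> K) : {poly K} :=
  \poly_(j < n) c (m + j%:Z).

Lemma convol_trunc (m p : int) (c d : int -> K) (n N : nat) :
  vanishes_below m c -> vanishes_below p d -> (n < N)%N ->
  convol c d (m + p + n%:Z) = (trunc m N c * trunc p N d)`_n.
Proof.
move=> cm dp nN; rewrite (convolE _ cm dp) coefM.
by apply: eq_bigr => -[j jn] _; rewrite !coef_poly/= !ifT//; lia.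
Qed.

Fact laurent_mul_subproof f g : exists m : int, vanishes_below m (convol f g).
Proof.
have [[m fm] [p gp]] := (laurentP f, laurentP g).
by exists (m + p); exact: convol_below.
Qed.
Definition laurent_mul f g := Laurent (laurent_mul_subproof f g).

Fact laurent_one_subproof : exists m : int, vanishes_below m (fun i => (i == 0)%:R : K).
Proof. by exists 0 => i; case: eqP => // ->. Qed.
Definition laurent_one := Laurent laurent_one_subproof.

Lemma convolC c d : (exists m : int, vanishes_below m c) ->
  (exists m : int, vanishes_below m d) -> convol c d =1 convol d c.
Proof.
move=> [m cm] [p dp] i; have [ilt|ige] := ltP i (m + p).
  by rewrite (convol_below cm dp ilt) (convol_below dp cm)// addrC.
have -> : i = m + p + (absz (i - (m + p))%R)%:Z by lia.
rewrite (convol_trunc cm dp (ltnSn _)) mulrC.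
by rewrite -(convol_trunc dp cm (ltnSn _)) (addrC p m).
Qed.

Fact laurent_mulC : commutative laurent_mul.
Proof.
by move=> f g; apply: lcoef_inj => i; apply: convolC; exact: laurentP.
Qed.

Fact laurent_mulA : associative laurent_mul.
Proof.
move=> f g h; apply: lcoef_inj => i /=.
have [[m fm] [p gp] [q hq]] := And3 (laurentP f) (laurentP g) (laurentP h).
have fg := convol_below fm gp; have gh := convol_below gp hq.
have [ilt|ige] := ltP i (m + p + q).
  by rewrite (convol_below fg hq ilt) (convol_below fm gh)// addrA.
have -> : i = m + p + q + (absz (i - (m + p + q))%R)%:Z by lia.
move: (absz _) => n.
transitivity ((trunc m n.+1 f * (trunc p n.+1 g * trunc q n.+1 h))`_n).
  rewrite -(addrA m p q) (convolE _ fm gh) coefM.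
  apply: eq_bigr => -[j jn] _ /=; rewrite coef_poly jn; congr (_ * _).
  by apply: convol_trunc => //; lia.
rewrite mulrA (convolE _ fg hq) coefM.
apply: eq_bigr => -[j jn] _ /=; rewrite (convol_trunc fm gp jn); congr (_ * _).
by rewrite coef_poly ifT//; lia.
Qed.

Fact laurent_mul1 : left_id laurent_one laurent_mul.
Proof.
move=> f; apply: lcoef_inj => i /=; rewrite /convol.
rewrite -(@fsbig_widen _ _ _ _ [set 0]) ?fsbig_set1 ?eqxx ?subr0 ?mul1r//.
by move=> j [_ /eqP/negbTE j0] /=; rewrite j0 mul0r.
Qed.

Fact laurent_mulDl : left_distributive laurent_mul laurent_add.
Proof.
move=> f g h; apply: lcoef_inj => i /=.
have [m [fm gm]] := common_lbound f g.
have [p hp] := laurentP h.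
have fgm : vanishes_below m (fun i => f i + g i).
  by move=> j jm; rewrite fm// gm// addr0.
have [ilt|ige] := ltP i (m + p).
  rewrite (convol_below fm hp ilt) (convol_below gm hp ilt) addr0.
  exact: (convol_below fgm hp ilt).
have -> : i = m + p + (absz (i - (m + p))%R)%:Z by lia.
rewrite [LHS](convolE _ fgm hp) (convolE _ fm hp) (convolE _ gm hp) -big_split/=.
by apply: eq_bigr => j _; rewrite mulrDl.
Qed.

Fact laurent_one_neq0 : laurent_one != 0.
Proof.
apply/eqP => /(congr1 (fun f : laurent K => f 0)) /=.
by move/eqP; rewrite oner_eq0.
Qed.

HB.instance Definition _ :=
  GRing.Zmodule_isComNzRing.Build (laurent K)
    laurent_mulA laurent_mulC laurent_mul1 laurent_mulDl laurent_one_neq0.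

Lemma lcoefM f g (i : int) :
  (f * g) i = \sum_(j \in [set: int]) f j * g (i - j).
Proof. by []. Qed.

Lemma lcoef1 (i : int) : (1 : laurent K) i = (i == 0)%:R.
Proof. by []. Qed.

Section Recip.
Variable a : nat -> K.
Hypothesis a0 : a 0%N != 0.

Fixpoint recip_seq (n : nat) : seq K :=
  if n isn't n'.+1 then [::] else
  let s := recip_seq n' in
  rcons s ((a 0%N)^-1 * ((n' == 0%N)%:R - \sum_(j < n') a j.+1 * s`_(n' - j.+1))).

Definition recip (n : nat) : K := (recip_seq n.+1)`_n.

Lemma size_recip_seq n : size (recip_seq n) = n.
Proof. by elim: n => //= n IH; rewrite size_rcons IH. Qed.

Lemma nth_recip_seq n i : (i < n)%N -> (recip_seq n)`_i = recip i.
Proof.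
elim: n => // n IH; rewrite ltnS leq_eqVlt => /predU1P[->//|lin].
by rewrite /= nth_rcons size_recip_seq lin IH.
Qed.

Lemma recipP n : \sum_(j < n.+1) a j * recip (n - j) = (n == 0%N)%:R.
Proof.
rewrite big_ord_recl subn0 {1}/recip /= nth_rcons size_recip_seq ltnn eqxx.
rewrite mulrA divff// mul1r; set S := \sum_(_ < _) _; set S' := \sum_(_ < _) _.
suff -> : S = S' by rewrite subrK.
apply: eq_bigr => -[j jn] _; rewrite /bump /= add1n nth_recip_seq//; lia.
Qed.

End Recip.

Lemma laurent_has_inv f : f != 0 -> exists g, g * f = 1.
Proof.
move=> f0; have [m fm] := laurentP f.
have [i fi] : exists i, f i != 0.
  apply: contrapT => nf; move/eqP: f0; apply; apply: lcoef_inj => i.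
  by apply/eqP; apply: contrapT => /negP fi; apply: nf; exists i.
have exn : exists n : nat, f (m + n%:Z) != 0.
  exists `|i - m|%N; have mi : m <= i by rewrite leNgt; apply: contra fi => /fm ->.
  by rewrite (_ : m + _ = i)//; lia.
case: (ex_minnP exn) => k fk kmin.
have fmk : vanishes_below (m + k%:Z) f.
  move=> j jmk; have [/fm//|mj] := ltP j m.
  apply/eqP; apply: contrapT => /negP fj.
  have := kmin `|j - m|%N; rewrite (_ : m + _ = j); last by lia.
  by move=> /(_ fj); lia.
pose a n := f (m + k%:Z + n%:Z).
have a0 : a 0%N != 0 by rewrite /a addr0.
pose c (j : int) : K := if j < - (m + k%:Z) then 0 else recip a (absz (j + (m + k%:Z))%R).
have cm : vanishes_below (- (m + k%:Z)) c by move=> j jm; rewrite /c jm.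
have cP : exists m, vanishes_below m c by exists (- (m + k%:Z)).
exists (Laurent cP); rewrite mulrC.
apply: lcoef_inj => j; rewrite lcoef1.
have [j0|j0] := ltP j 0.
  rewrite [LHS](convol_below fmk cm) ?subrr//.
  by case: eqP j0 => // ->.
have jE : j = m + k%:Z - (m + k%:Z) + `|j|%N%:Z by lia.
rewrite {1}jE [LHS](convolE _ fmk cm).
transitivity (\sum_(l < `|j|.+1) a l * recip a (`|j| - l)).
  apply: eq_bigr => -[l lj] _ /=; congr (_ * _); rewrite /c ifF; last by lia.
  by congr recip; lia.
by rewrite recipP// absz_eq0.
Qed.

Definition laurent_inv f : laurent K :=
  if pselect (exists g, g * f = 1) is left h then projT1 (cid h) else 0.

Fact laurent_mulVl f : f != 0 -> laurent_inv f * f = 1.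
Proof.
move=> /laurent_has_inv h; rewrite /laurent_inv.
by case: pselect => // h'; case: cid.
Qed.

Fact laurent_inv0 : laurent_inv 0 = 0.
Proof.
rewrite /laurent_inv; case: pselect => // h; exfalso; case: h => g /eqP.
by rewrite mulr0 eq_sym oner_eq0.
Qed.

HB.instance Definition _ :=
  GRing.ComNzRing_isField.Build (laurent K) laurent_mulVl laurent_inv0.

Fact laurent_var_subproof : exists m : int, vanishes_below m (fun i => (i == 1)%:R : K).
Proof. by exists 0 => i; case: eqP => // ->. Qed.

(* the indeterminate t *)
Definition laurent_var := Laurent laurent_var_subproof.

(* K[[t]] as a subring of K((t)) *)
Definition power_series : {pred laurent K} :=
  fun f => `[< vanishes_below 0 f >].

Fact power_series_subring : subring_closed power_series.
Proof.
split=> [|f g /asboolP f0 /asboolP g0|f g /asboolP f0 /asboolP g0].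
- by apply/asboolP => i; rewrite lcoef1; case: eqP => // ->.
- by apply/asboolP => i i0; rewrite [LHS](_ : _ = f i - g i)// f0// g0// subr0.
- by apply/asboolP; rewrite -[0]addr0; exact: convol_below.
Qed.

HB.instance Definition _ :=
  GRing.isSubringClosed.Build (laurent K) power_series power_series_subring.

(* GL(n, K[[t]]) inside GL(n, K((t))): the inverse has entries in K[[t]] too. *)
Definition GL_power_series (n : nat) (P : 'M[laurent K]_n) : Prop :=
  [/\ P \is a mxOver power_series, P \in unitmx
    & invmx P \is a mxOver power_series].

Definition invariant_factors (n : nat) (A : 'M[laurent K]_n)
    (v : 'I_n -> int) : Prop :=
  (forall i j : 'I_n, (i <= j)%N -> v j <= v i) /\
  exists P Q : 'M[laurent K]_n,
    [/\ GL_power_series P, GL_power_series Q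
      & A = P *m diag_mx (\row_i (laurent_var ^ v i)) *m Q].

End LaurentField.

Section Convergence.
Variable C : numFieldType.

(* A lower bound for the exponents of [f]: the value of the sum below does not
   depend on which one is chosen. *)
Definition lower_exponent (f : laurent C) : int := projT1 (cid (laurentP f)).

Definition laurent_series (f : laurent C) (z : C) : C ^nat :=
  [series f (lower_exponent f + n%:Z) * z ^ (lower_exponent f + n%:Z)]_n.

Definition laurent_converges (f : laurent C) (z : C) : Prop :=
  cvgn (laurent_series f z).

Definition laurent_eval (f : laurent C) (z : C) : C :=
  limn (laurent_series f z).

Definition laurent_mx_eval (n : nat) (A : 'M[laurent C]_n) (z : C) : 'M[C]_n :=
  \matrix_(i, j) laurent_eval (A i j) z.

End Convergence.

(* the roots of the characteristic polynomial, repeated according to their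
   multiplicities *)
Definition eigenvalues (C : closedFieldType) (n : nat) (M : 'M[C]_n) : seq C :=
  sval (closed_field_poly_normal (char_poly M)).

(* Since B B^* is positive semi-definite, its eigenvalues are nonnegative reals,
   so taking their real part loses nothing. *)
Definition singular_values (R : realType) (n : nat) (B : 'M[R[i]]_n) : seq R :=
  sort <=%R [seq Num.sqrt (complex.Re z) |
             z <- eigenvalues (B *m map_mx Num.conj B^T)].

Definition logb (R : realType) (b x : R) : R := ln x / ln b.

(* Main.v *)
(** Let [tau] be the diagonal factor of the Smith form [A = P tau Q].  The factors
    [P], [Q] need not converge, but replacing them by truncations [P'], [Q'] at a
    high order [N] gives matrices of polynomials with
    [A(t) = P'(t) tau(t) Q'(t) + O(t^M)], where [M] exceeds all the [v_i];
    likewise [tau(t) = P''(t) A(t) Q''(t) + O(t^M)] with truncations of [P^-1]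
    and [Q^-1].  If [B = X D Y + F], a dimension count on eigenvectors of [B B^*]
    and [D D^*] bounds the i-th singular value of [B] by a multiple of that of [D],
    up to the size of [F].  Both relations together trap [d_i(t)] between two
    positive multiples of [t^(v_i)], and taking logarithms concludes. *)

Require Import Defs.
From HB Require Import structures.
From mathcomp Require Import all_boot all_order all_algebra.
From mathcomp Require Import all_classical all_reals all_analysis.
From mathcomp Require Import complex fingroup perm zify ring lra.

Set Implicit Arguments.
Unset Strict Implicit.
Unset Printing Implicit Defensive.

Import Order.TTheory GRing.Theory Num.Theory.
Import numFieldNormedType.Exports.

Local Open Scope classical_set_scope.
Local Open Scope ring_scope.
Local Open Scope complex_scope.

(** * Singular values of products *)

Section SingularValueComparison.
Variable C : numClosedFieldType.
Local Open Scope sesquilinear_scope.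

Definition sqnorm n (u : 'rV[C]_n) : C := \sum_j `|u 0 j| ^+ 2.

Lemma sqnormE n (u : 'rV[C]_n) : sqnorm u = (u *m u^t*) 0 0.
Proof. by rewrite mxE; apply: eq_bigr => j _; rewrite !mxE normCK. Qed.

Lemma sqnorm_ge0 n (u : 'rV[C]_n) : 0 <= sqnorm u.
Proof. by apply: sumr_ge0 => j _; rewrite exprn_ge0. Qed.

Lemma sqnorm_eq0 n (u : 'rV[C]_n) : (sqnorm u == 0) = (u == 0).
Proof.
apply/eqP/eqP => [/psumr_eq0P u0|->].
  apply/rowP => j; apply/eqP; rewrite mxE -normr_eq0 -sqrf_eq0.
  by apply/eqP/u0 => // k _; rewrite exprn_ge0.
by rewrite /sqnorm big1 // => j _; rewrite mxE normr0 expr0n.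
Qed.

Lemma sqnormD n (u v : 'rV[C]_n) :
  sqnorm (u + v) <= 2 * sqnorm u + 2 * sqnorm v.
Proof.
rewrite !mulr_sumr -big_split; apply: ler_sum => j _; rewrite mxE /=.
have abD := ler_normD (u 0 j) (v 0 j).
have sq : (`|u 0 j| + `|v 0 j|) ^+ 2 <= 2 * `|u 0 j| ^+ 2 + 2 * `|v 0 j| ^+ 2.
  rewrite -subr_ge0.
  have -> : 2 * `|u 0 j| ^+ 2 + 2 * `|v 0 j| ^+ 2 - (`|u 0 j| + `|v 0 j|) ^+ 2
            = (`|u 0 j| - `|v 0 j|) ^+ 2 by ring.
  by rewrite real_exprn_even_ge0 // realB // normr_real.
by apply: le_trans sq; rewrite ler_sqr ?nnegrE ?addr_ge0.
Qed.

(** With [s] the norm of [u], each entry of [u *m X] is a sum of [n] terms of modulus at most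
    [s * x]; adding up [n] squares of such entries gives the factor [n ^ 3]. *)
Lemma sqnorm_mulmx_le n (X : 'M[C]_n) (x : C) (u : 'rV[C]_n) :
  (forall i j, `|X i j| <= x) ->
  sqnorm (u *m X) <= n%:R ^+ 3 * x ^+ 2 * sqnorm u.
Proof.
case: n X u => [|n] X u Xx.
  by rewrite /sqnorm !big_ord0 mulr0.
have x0 : 0 <= x by exact: le_trans (Xx 0 0).
pose s := sqrtC (sqnorm u).
have s0 : 0 <= s by rewrite sqrtC_ge0 sqnorm_ge0.
have ss : s ^+ 2 = sqnorm u by rewrite sqrtCK.
have us j : `|u 0 j| <= s.
  rewrite -(@ler_pXn2r _ 2) ?nnegrE // ss /sqnorm (bigD1 j) //= lerDl.
  by apply: sumr_ge0 => k _; rewrite exprn_ge0.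
have uX j : `|(u *m X) 0 j| <= n.+1%:R * (s * x).
  rewrite mxE; apply: le_trans (ler_norm_sum _ _ _) _.
  rewrite mulr_natl -[X in _ *+ X]card_ord -sumr_const.
  by apply: ler_sum => k _; rewrite normrM ler_pM.
have -> : n.+1%:R ^+ 3 * x ^+ 2 * sqnorm u =
          \sum_(j < n.+1) (n.+1%:R * (s * x)) ^+ 2.
  rewrite sumr_const card_ord -mulr_natl -ss; ring.
by apply: ler_sum => j _; rewrite ler_sqr ?nnegrE ?mulr_ge0.
Qed.

(** These are the eigenvalues of [B B^*] with multiplicity, listed in the order of the rows of [W],
    which form an orthonormal basis of left eigenvectors. *)
Definition gram_eigenvalues n (B : 'M[C]_n) (e : 'I_n -> C) :=
  exists2 W : 'M[C]_n, W \is unitarymx &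
    B *m B^t* = W^t* *m diag_mx (\row_i e i) *m W.

Lemma gram_eigenvalues_ge0 n (B : 'M[C]_n) e i :
  gram_eigenvalues B e -> 0 <= e i.
Proof.
move=> [W /unitarymxP WW BB].
have -> : e i = ((W *m B) *m (W *m B)^t*) i i.
  transitivity (diag_mx (\row_i e i) i i); first by rewrite !mxE eqxx mulr1n.
  rewrite trmx_mul map_mxM mulmxA -(mulmxA W) BB !mulmxA WW mul1mx.
  by rewrite -mulmxA WW mulmx1.
rewrite mxE; apply: sumr_ge0 => k _.
by rewrite [X in _ * X]mxE [X in _ * X^*]mxE mul_conjC_ge0.
Qed.

Lemma sqnorm_unitary n (W : 'M[C]_n) (u : 'rV[C]_n) :
  W \is unitarymx -> sqnorm (u *m W) = sqnorm u.
Proof.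
move=> /unitarymxP WW; rewrite !sqnormE trmx_mul map_mxM mulmxA.
by rewrite -(mulmxA u) WW mulmx1.
Qed.

(** [w] holds the coordinates of [u = w *m W] in the eigenbasis, in which the Hermitian form
    [u B B^* u^*] is diagonal. *)
Lemma sqnorm_gram n (B : 'M[C]_n) e (W : 'M[C]_n) (w : 'rV[C]_n) :
  W \is unitarymx -> B *m B^t* = W^t* *m diag_mx (\row_i e i) *m W ->
  sqnorm (w *m W *m B) = \sum_k e k * `|w 0 k| ^+ 2.
Proof.
move=> /unitarymxP WW BB.
rewrite sqnormE trmx_mul map_mxM mulmxA -(mulmxA _ B) BB trmx_mul map_mxM.
rewrite !mulmxA -(mulmxA w W) WW mulmx1 -(mulmxA _ W (W^t*)) WW mulmx1.
rewrite mxE; apply: eq_bigr => k _.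
by rewrite mul_mx_diag !mxE normCK mulrAC mulrA; ring.
Qed.

(* For each index [i], the eigenvectors of [B B^*] of index [>= i] span a space
   meeting the preimage under [X] of those of [D D^*] of index [<= i]; the
   vector [u] below lies in that intersection. *)
Lemma gram_eigenvalues_le n (B D X Y F : 'M[C]_n) (e d : 'I_n -> C)
    (kx ky kf : C) :
  gram_eigenvalues B e -> gram_eigenvalues D d ->
  {homo e : i j / (i <= j)%N >-> i <= j} ->
  {homo d : i j / (i <= j)%N >-> i <= j} ->
  0 <= kx -> 0 <= ky ->
  (forall u : 'rV[C]_n, sqnorm (u *m X) <= kx * sqnorm u) ->
  (forall u : 'rV[C]_n, sqnorm (u *m Y) <= ky * sqnorm u) ->
  (forall u : 'rV[C]_n, sqnorm (u *m F) <= kf * sqnorm u) ->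
  B = X *m D *m Y + F ->
  forall i, e i <= 2 * (kx * ky * d i) + 2 * kf.
Proof.
move=> He Hd emono dmono kx0 ky0 HX HY HF BE i.
have d0 := gram_eigenvalues_ge0 i Hd.
have [[W Wu BB] [V Vu DD]] := (He, Hd).
(* [M] expresses [X] in the two eigenbases: it sends the [W]-coordinates of [u] to the
   [V]-coordinates of [u *m X]. *)
pose M := W *m X *m V^t*.
(* [w *m Z = 0] collects the conditions: columns before [i] make [w] vanish there, columns after [i]
   make [w *m M] vanish there. Column [i] is zero, so [Z] is singular and a nonzero [w] exists. *)
pose Z := \matrix_(r, k) if (k < i)%N then (r == k)%:R
                         else if k == i then 0 else M r k.
have /det0P[w w0 wZ] : \det Z == 0.
  rewrite (expand_det_col _ i); apply/eqP; apply: big1 => r _.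
  by rewrite mxE ltnn eqxx mul0r.
have wlt (k : 'I_n) : (k < i)%N -> w 0 k = 0.
  move=> ki; have /rowP/(_ k) := wZ; rewrite !mxE (bigD1 k) //= mxE ki eqxx mulr1.
  by rewrite big1 ?addr0 // => r rk; rewrite mxE ki (negbTE rk) mulr0.
have wgt (k : 'I_n) : (i < k)%N -> (w *m M) 0 k = 0.
  move=> ik; have /rowP/(_ k) := wZ; rewrite !mxE => wZk; rewrite -[RHS]wZk.
  apply: eq_bigr => r _; rewrite [in RHS]mxE ltnNge ltnW //=.
  by rewrite (gtn_eqF ik : (k == i) = false).
set u := w *m W; have su : sqnorm u = sqnorm w by rewrite sqnorm_unitary.
have su0 : 0 < sqnorm u by rewrite su lt0r sqnorm_eq0 w0 sqnorm_ge0.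
(* Only the [e k] with [k >= i] contribute here; in [up] below, only the [d k] with [k <= i]. *)
have low : e i * sqnorm u <= sqnorm (u *m B).
  rewrite su (sqnorm_gram _ Wu BB) mulr_sumr; apply: ler_sum => k _.
  have [ki|ik] := ltnP k i; first by rewrite wlt // normr0 expr0n !mulr0.
  by rewrite ler_wpM2r ?exprn_ge0 // emono.
have uXE : u *m X = (w *m M) *m V.
  by rewrite /M !mulmxA -(mulmxA _ (V^t*)) (mulmx1C (unitarymxP Vu)) mulmx1.
have up : sqnorm (u *m X *m D) <= d i * sqnorm (u *m X).
  rewrite uXE (sqnorm_gram _ Vu DD) sqnorm_unitary // mulr_sumr.
  apply: ler_sum => k _.
  have [ik|ki] := ltnP i k; first by rewrite wgt // normr0 expr0n !mulr0.
  by rewrite ler_wpM2r ?exprn_ge0 // dmono.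
rewrite -(ler_pM2r su0); apply: le_trans low _.
rewrite BE mulmxDr !mulmxA mulrDl; apply: le_trans (sqnormD _ _) _.
rewrite -!(mulrA 2); apply: lerD; rewrite ler_pM2l //.
apply: le_trans (HY _) _; rewrite (mulrC kx) -!mulrA ler_wpM2l //.
by apply: le_trans up _; rewrite mulrCA ler_wpM2l.
Qed.

(** This is the spectral theorem for the normal matrix [B B^*]. The characteristic polynomial serves
    to identify [l] with the roots in [eigenvalues], multiplicities included. *)
Lemma gram_spectral n (B : 'M[C]_n) :
  exists2 l : 'I_n -> C, gram_eigenvalues B l &
    char_poly (B *m B^t*) = \prod_i ('X - (l i)%:P).
Proof.
have /orthomx_spectralP : B *m B^t* \is normalmx.
  by apply/normalmxP; rewrite trmx_mul map_mxM trmxCK.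
set W := spectralmx _; set l := spectral_diag _.
have Wu : W \is unitarymx by exact: spectral_unitarymx.
have lE : \row_i l 0 i = l by apply/rowP => i; rewrite mxE.
rewrite (invmx_unitary Wu) => BB; exists (l 0).
  by exists W; rewrite ?lE.
have WWP : map_mx polyC (W^t*) *m map_mx polyC W = 1%:M.
  by rewrite -map_mxM (mulmx1C (unitarymxP Wu)) map_mx1.
transitivity (char_poly (diag_mx l)); last first.
  rewrite char_poly_trig ?diag_mx_is_trig //.
  by apply: eq_bigr => i _; rewrite mxE eqxx mulr1n.
rewrite /char_poly BB.
have -> : char_poly_mx (W^t* *m diag_mx l *m W) =
  map_mx polyC (W^t*) *m char_poly_mx (diag_mx l) *m map_mx polyC W.
  rewrite /char_poly_mx mulmxBr mulmxBl !map_mxM.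
  by rewrite mul_mx_scalar -scalemxAl WWP scalemx1.
by rewrite !det_mulmx mulrAC -det_mulmx WWP det1 mul1r.
Qed.

(** Permuting the rows of [W] keeps it unitary; this allows the eigenvalues to be sorted. *)
Lemma gram_eigenvalues_perm n (B : 'M[C]_n) (l : 'I_n -> C) (s : 'S_n) :
  gram_eigenvalues B l -> gram_eigenvalues B (l \o s).
Proof.
move=> [W Wu BB]; exists (row_perm s W).
  apply/unitarymxP; rewrite row_permE trmx_mul map_mxM mulmxA.
  rewrite -(mulmxA _ W) (unitarymxP Wu) mulmx1.
  by rewrite tr_perm_mx map_perm_mx -perm_mxM mulgV perm_mx1.
rewrite BB.
apply/matrixP => i j; rewrite !mul_mx_diag !mxE.
rewrite (reindex_inj (@perm_inj _ s)) /=; apply: eq_bigr => k _.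
by rewrite !mxE.
Qed.
End SingularValueComparison.

(** * Truncation and convergence of Laurent series *)

Section LaurentTruncation.
Variable K : fieldType.
Implicit Types f g : laurent K.

Fact lmono_subproof (c : K) (k : int) :
  exists m : int, vanishes_below m (fun i => if i == k then c else 0).
Proof. by exists k => i; case: eqP => // ->; rewrite ltxx. Qed.

Definition lmono (c : K) (k : int) : laurent K := Laurent (lmono_subproof c k).

Lemma lcoef_monoM (c : K) (k : int) f (i : int) :
  (lmono c k * f) i = c * f (i - k).
Proof.
rewrite lcoefM -(@fsbig_widen _ _ _ _ [set k]) ?fsbig_set1 /= ?eqxx //.
by move=> j [_ /eqP/negbTE jk] /=; rewrite jk mul0r.
Qed.

Lemma lcoefD f g (i : int) : (f + g) i = f i + g i. Proof. by []. Qed.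

Lemma lcoefN f (i : int) : (- f) i = - f i. Proof. by []. Qed.

Lemma lcoef_sum (I : finType) (F : I -> laurent K) (i : int) :
  (\sum_k F k) i = \sum_k F k i.
Proof. by apply: (big_morph (fun f : laurent K => f i)). Qed.

Lemma laurent_var_exp (k : int) : laurent_var K ^ k = lmono 1 k.
Proof.
have E (n : nat) : laurent_var K ^+ n = lmono 1 n.
  elim: n => [|n IHn]; apply: lcoef_inj => i; first by rewrite expr0 lcoef1 /=; case: eqP.
  have -> : laurent_var K ^+ n.+1 = lmono 1 1 * laurent_var K ^+ n.
    by rewrite exprS; congr (_ * _); apply: lcoef_inj => j /=; case: eqP.
  rewrite IHn lcoef_monoM mul1r /=.
  by rewrite (_ : (i - 1 == n) = (i == n.+1)) //; lia.
case: k => n; first exact: E.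
rewrite NegzE -exprnN E.
(* The field inverse is obtained by choice, so the negative power is identified by cancellation,
   from an explicit inverse of [t^(n+1)]. *)
have u : lmono 1 (- n.+1%:Z) * lmono 1 n.+1 = 1.
  apply: lcoef_inj => i; rewrite lcoef_monoM mul1r lcoef1 /=.
  by rewrite (_ : (i - - n.+1%:Z == n.+1) = (i == 0)); [case: eqP|lia].
have n0 : lmono 1 n.+1 != 0.
  by apply: contra_eq_neq u => ->; rewrite mulr0 eq_sym oner_eq0.
by apply: (mulIf n0); rewrite u mulVf.
Qed.

Definition ltrunc (N : nat) f : laurent K := \sum_(k < N) lmono (f k) k.

Lemma lcoef_trunc N f (i : int) :
  ltrunc N f i = if (0 <= i) && (i < N%:Z) then f i else 0.
Proof.
rewrite lcoef_sum; case: ifPn => [/andP[i0 iN]|iN].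
  have hN : (absz i < N)%N by lia.
  rewrite (bigD1 (Ordinal hN)) //= ifT; last by apply/eqP; lia.
  rewrite big1 ?addr0; first by congr (f _); lia.
  move=> k kN /=; rewrite ifF //; apply: contraNF kN => /eqP ik.
  by apply/eqP/val_inj => /=; lia.
by apply: big1 => -[k kN] _ /=; rewrite ifF //; apply: contraNF iN => /eqP ->; lia.
Qed.

Definition mx_vanishes_below m p (e : int) (A : 'M[laurent K]_(m, p)) :=
  forall i j, vanishes_below e (A i j).

Lemma vanishes_belowD (e : int) f g :
  vanishes_below e f -> vanishes_below e g -> vanishes_below e (f + g).
Proof. by move=> fe ge i ie; rewrite lcoefD fe // ge // addr0. Qed.

Lemma mx_vanishes_belowM m p q (e e' : int) (A : 'M[laurent K]_(m, p))
    (B : 'M[laurent K]_(p, q)) :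
  mx_vanishes_below e A -> mx_vanishes_below e' B ->
  mx_vanishes_below (e + e') (A *m B).
Proof.
move=> Ae Be i j k ke; rewrite mxE lcoef_sum big1 // => l _.
exact: (convol_below (Ae i l) (Be l j)).
Qed.

(* Replacing the outer factors by their truncations at order [N] only
   changes the coefficients of order at least [N + e]. *)
Lemma mx_trunc_mul n (N : nat) (e : int) (P B Q : 'M[laurent K]_n) :
  P \is a mxOver (@power_series K) -> Q \is a mxOver (@power_series K) ->
  mx_vanishes_below e B ->
  mx_vanishes_below (N%:Z + e)
    (P *m B *m Q - map_mx (ltrunc N) P *m B *m map_mx (ltrunc N) Q).
Proof.
move=> PS QS Be.
have trN (f : laurent K) :
    f \in @power_series K -> vanishes_below N%:Z (f - ltrunc N f).
  move=> /asboolP f0 i iN; rewrite lcoefD lcoefN lcoef_trunc iN andbT.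
  by case: leP => i0; rewrite ?subrr // f0 // subr0.
have tr0 (f : laurent K) : vanishes_below 0 (ltrunc N f).
  by move=> i i0; rewrite lcoef_trunc leNgt i0.
set P' := map_mx _ P; set Q' := map_mx _ Q.
have -> : P *m B *m Q - P' *m B *m Q' = (P - P') *m B *m Q + P' *m B *m (Q - Q').
  by rewrite !(mulmxBl, mulmxBr) addrA subrK.
have PP : mx_vanishes_below N%:Z (P - P').
  by move=> i j; rewrite !mxE; apply: trN; exact: (mxOverP PS).
have QQ : mx_vanishes_below N%:Z (Q - Q').
  by move=> i j; rewrite !mxE; apply: trN; exact: (mxOverP QS).
have Q0 : mx_vanishes_below 0 Q.
  by move=> i j; apply/asboolP; exact: (mxOverP QS).
have P0 : mx_vanishes_below 0 P' by move=> i j; rewrite mxE.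
move=> i j; rewrite mxE; apply: vanishes_belowD.
  have := mx_vanishes_belowM (mx_vanishes_belowM PP Be) Q0.
  by rewrite addr0 => /(_ i j).
have := mx_vanishes_belowM (mx_vanishes_belowM P0 Be) QQ.
by rewrite add0r addrC => /(_ i j).
Qed.

End LaurentTruncation.

(** * Values of Laurent series at a point and their growth near the origin *)

Section LaurentSums.
Variable C : numFieldType.
Implicit Types (f g : laurent C) (z l : C).

Lemma norm_exprz (z : C) (k : int) : `|z ^ k| = `|z| ^ k.
Proof. by case: k => k; rewrite ?NegzE -?exprnN ?normfV normrX. Qed.

Definition series_from (m : int) f z : C ^nat :=
  [series f (m + n%:Z) * z ^ (m + n%:Z)]_n.

Lemma series_fromE (m : int) f z n :
  series_from m f z n = \sum_(k < n) f (m + k%:Z) * z ^ (m + k%:Z).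
Proof. by rewrite /series_from /series /= big_mkord. Qed.

(** A relation rather than a value: convergence and limit travel together, and the starting exponent
    may be any lower bound, since leading zero terms do not change the limit. *)
Definition laurent_sums f z l :=
  exists2 m : int, vanishes_below m f & series_from m f z @ \oo --> l.

Lemma series_from_shift (m : int) (k : nat) f z l :
  vanishes_below (m + k%:Z) f ->
  (series_from m f z @ \oo --> l) <-> (series_from (m + k%:Z) f z @ \oo --> l).
Proof.
move=> fk; rewrite -(cvg_shiftn k (series_from m f z)).
suff -> : [sequence series_from m f z (n + k)%N]_n = series_from (m + k%:Z) f z by [].
apply/funext => n; rewrite /series_from /series /=.
rewrite (@big_cat_nat _ _ _ k) ?leq_addl //= big_nat big1 ?add0r; last first.
  by move=> j /andP[_ jk]; rewrite fk ?mul0r //; lia.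
rewrite -{1}(add0n k) big_addn addnK; apply: eq_bigr => j _.
by rewrite (_ : m + (j + k)%N%:Z = m + k%:Z + j%:Z) //; lia.
Qed.

Lemma laurent_sums_from (m : int) f z l :
  vanishes_below m f -> laurent_sums f z l -> series_from m f z @ \oo --> l.
Proof.
move=> fm [p fp]; have [mp|pm] := leP m p.
  have pE : p = m + (absz (p - m)%R)%:Z by lia.
  by move: fp; rewrite pE => fp; apply: (series_from_shift _ _ fp).2.
have mE : m = p + (absz (m - p)%R)%:Z by lia.
by move: fm; rewrite mE => fm; apply: (series_from_shift _ _ fm).1.
Qed.

Lemma laurent_sums_eval f z :
  laurent_converges f z -> laurent_sums f z (laurent_eval f z).
Proof.
by move=> fz; exists (lower_exponent f) => //; rewrite /lower_exponent; case: cid.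
Qed.

Lemma laurent_sumsD f g z l l' :
  laurent_sums f z l -> laurent_sums g z l' -> laurent_sums (f + g) z (l + l').
Proof.
move=> fl gl; have [m [fm gm]] := common_lbound f g.
exists m; first exact: vanishes_belowD.
rewrite (_ : series_from m (f + g) z = series_from m f z + series_from m g z).
  exact: cvgD (laurent_sums_from fm fl) (laurent_sums_from gm gl).
apply/funext => n; rewrite -[RHS]/(series_from m f z n + series_from m g z n).
rewrite !series_fromE -big_split; apply: eq_bigr => k _.
by rewrite lcoefD mulrDl.
Qed.

(** Moving the lower bound by [k] makes the partial sums proportional term by term. Products with
    polynomials follow by linearity, so no Cauchy product of two infinite series arises. *)
Lemma laurent_sums_monoM f z l (c : C) (k : int) : z != 0 ->
  laurent_sums f z l -> laurent_sums (lmono c k * f) z (c * z ^ k * l).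
Proof.
move=> z0 [m fm fl]; exists (m + k).
  by move=> i im; rewrite lcoef_monoM fm ?mulr0 //; lia.
rewrite (_ : series_from _ _ _ = fun n => c * z ^ k * series_from m f z n).
  exact: cvgMl_tmp fl.
apply/funext => n.
rewrite !series_fromE mulr_sumr; apply: eq_bigr => j _.
rewrite lcoef_monoM (_ : m + k + j - k = m + j); last by lia.
rewrite (_ : m + k + j = k + (m + j)); last by lia.
by rewrite expfzDr //; ring.
Qed.

Lemma laurent_sums0 z : laurent_sums 0 z 0.
Proof.
exists 0 => //; rewrite [X in X @ _](_ : _ = cst 0); first exact: cvg_cst.
by apply/funext => n; rewrite series_fromE big1 // => j _; rewrite mul0r.
Qed.

Lemma laurent_sums1 z : laurent_sums 1 z 1.
Proof.
exists 0; first by move=> i i0; rewrite lcoef1 lt_eqF.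
rewrite -(cvg_shiftn 1) [X in X @ _](_ : _ = cst 1); first exact: cvg_cst.
apply/funext => n; rewrite /= addn1 series_fromE big_ord_recl lcoef1.
rewrite big1 => [|j _]; last by rewrite lcoef1 mul0r.
by rewrite addr0 mulr1.
Qed.

Lemma laurent_sums_sum (I : finType) (F : I -> laurent C) z (L : I -> C) :
  (forall k, laurent_sums (F k) z (L k)) ->
  laurent_sums (\sum_k F k) z (\sum_k L k).
Proof.
move=> FL; apply: (big_ind2 (fun f l => laurent_sums f z l)) => //.
  exact: laurent_sums0.
by move=> *; exact: laurent_sumsD.
Qed.

Lemma laurent_sumsN f z l :
  z != 0 -> laurent_sums f z l -> laurent_sums (- f) z (- l).
Proof.
move=> z0 /(laurent_sums_monoM (-1) 0 z0); rewrite expr0z mulr1 mulN1r.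
congr laurent_sums; apply: lcoef_inj => i.
by rewrite lcoef_monoM subr0 mulN1r.
Qed.

(** The value at [z] of the polynomial [ltrunc N f], defined even where [f] itself diverges. *)
Definition trunc_eval (N : nat) (z : C) f : C := \sum_(k < N) f k * z ^+ k.

Lemma laurent_sums_truncM (N : nat) f g z l : z != 0 ->
  laurent_sums f z l -> laurent_sums (ltrunc N g * f) z (trunc_eval N z g * l).
Proof.
move=> z0 fl; rewrite !mulr_suml; apply: laurent_sums_sum => k.
exact: laurent_sums_monoM.
Qed.

Lemma trunc_eval_bounded (N : nat) f :
  exists2 K : C, 0 <= K & forall z, `|z| <= 1 -> `|trunc_eval N z f| <= K.
Proof.
exists (\sum_(k < N) `|f k|); first exact: sumr_ge0.
move=> z z1; apply: le_trans (ler_norm_sum _ _ _) _; apply: ler_sum => k _.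
by rewrite normrM normrX ler_piMr // exprn_ile1.
Qed.

Definition mx_sums m p (A : 'M[laurent C]_(m, p)) z (B : 'M[C]_(m, p)) :=
  forall i j, laurent_sums (A i j) z (B i j).

Lemma mx_sums_truncMl (N : nat) m p q (P : 'M[laurent C]_(m, p))
    (A : 'M[laurent C]_(p, q)) z B : z != 0 -> mx_sums A z B ->
  mx_sums (map_mx (ltrunc N) P *m A) z (map_mx (trunc_eval N z) P *m B).
Proof.
move=> z0 AB i j; rewrite !mxE; apply: laurent_sums_sum => k.
by rewrite !mxE; exact: laurent_sums_truncM.
Qed.

Lemma mx_sums_truncMr (N : nat) m p q (P : 'M[laurent C]_(p, q))
    (A : 'M[laurent C]_(m, p)) z B : z != 0 -> mx_sums A z B ->
  mx_sums (A *m map_mx (ltrunc N) P) z (B *m map_mx (trunc_eval N z) P).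
Proof.
move=> z0 AB i j; rewrite !mxE; apply: laurent_sums_sum => k.
by rewrite !mxE mulrC [B _ _ * _]mulrC; exact: laurent_sums_truncM.
Qed.

Lemma mx_sums_diag n (v : 'I_n -> int) z : z != 0 ->
  mx_sums (diag_mx (\row_i (laurent_var C ^ v i))) z (diag_mx (\row_i z ^ v i)).
Proof.
move=> z0 i j; rewrite !mxE; case: eqP => _; last exact: laurent_sums0.
rewrite !mulr1n laurent_var_exp -[lmono _ _]mulr1.
rewrite -[z ^ _]mul1r -[1 * _]mulr1; apply: laurent_sums_monoM => //.
exact: laurent_sums1.
Qed.

Lemma mx_sumsB m p (A A' : 'M[laurent C]_(m, p)) z B B' : z != 0 ->
  mx_sums A z B -> mx_sums A' z B' -> mx_sums (A - A') z (B - B').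
Proof.
move=> z0 AB AB' i j; rewrite !mxE; apply: laurent_sumsD => //.
exact: laurent_sumsN.
Qed.

(** Convergence at [w] bounds the terms at [w] by some [B]. For [|z| <= |w| / 2] the terms at [z]
    are then dominated by a geometric series of ratio at most 1/2 starting at order [M], with a
    constant uniform in [z]. *)
Lemma laurent_sums_bound (M : int) f (w l0 : C) : w != 0 ->
  vanishes_below M f -> laurent_sums f w l0 ->
  exists2 K : C, 0 <= K &
    forall z l, 0 < `|z| -> 2 * `|z| <= `|w| -> laurent_sums f z l ->
      `|l| <= K * `|z| ^ M.
Proof.
move=> w0 fM /(laurent_sums_from fM) fw.
have [B B0 fB] : exists2 B : C, 0 <= B &
    forall n : nat, `|f (M + n%:Z)| * `|w| ^ (M + n%:Z) <= B.
  have /cvg_series_cvg_0 /cvgP /cvg_seq_bounded[B [Br HB]] : cvgn (series_from M f w).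
    by apply/cvg_ex; exists l0.
  exists (`|B| + 1) => [|n]; first by rewrite addr_ge0.
  rewrite -norm_exprz -normrM; apply: HB => //.
  by rewrite (le_lt_trans (real_ler_norm Br)) // ltrDl.
(* The factor 2 bounds the geometric sum, and [|w| ^ (- M) * |z| ^ M] is [x ^ M] for the ratio [x]
   below. *)
exists (2 * B * `|w| ^ (- M)).
  by rewrite !mulr_ge0 // exprz_ge0.
move=> z l z0 zw /(laurent_sums_from fM) fl.
have w0' : 0 < `|w| by rewrite normr_gt0.
pose x : C := `|z| / `|w|.
have x0 : 0 < x by rewrite divr_gt0.
have x2 : 2 * x <= 1 by rewrite mulrA ler_pdivrMr // mul1r.
have zE : `|z| = x * `|w| by rewrite divfK // gt_eqF.
(* From [(1 - x) S <= 1] and [2 x <= 1] one gets [2 S <= 2 + S]. *)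
have geom n : \sum_(k < n) x ^+ k <= 2.
  have S0 : 0 <= \sum_(k < n) x ^+ k by apply: sumr_ge0 => k _; rewrite exprn_ge0 // ltW.
  have : (1 - x) * \sum_(k < n) x ^+ k <= 1.
    by rewrite -opprB mulNr -subrX1 opprB gerBl exprn_ge0 // ltW.
  move: (\sum_(k < n) x ^+ k) S0 => S S0 xS.
  have : 2 * ((1 - x) * S) + 2 * x * S <= 2 * 1 + 1 * S.
    by apply: lerD; rewrite ?ler_pM2l // ler_wpM2r.
  by rewrite (_ : _ + _ = S + S) ?mulr1 ?mul1r ?lerD2r //; ring.
have partial n : `|series_from M f z n| <= 2 * B * `|w| ^ (- M) * `|z| ^ M.
  rewrite series_fromE; apply: le_trans (ler_norm_sum _ _ _) _.
  rewrite [leRHS](_ : _ = B * x ^ M * 2); last first.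
    by rewrite zE expfzMl -invr_expz; field; rewrite expfz_neq0 ?gt_eqF.
  apply: (@le_trans _ _ (\sum_(k < n) B * x ^ M * x ^+ k)).
    apply: ler_sum => k _; rewrite normrM norm_exprz zE expfzMl mulrCA.
    rewrite -mulrA [leRHS]mulrC.
    by rewrite (exprnP x) -expfzDr ?gt_eqF // ler_wpM2l // exprz_ge0 // ltW.
  by rewrite -mulr_sumr ler_wpM2l // mulr_ge0 // exprz_ge0 // ltW.
apply/ler_addgt0Pl => e e0.
have /cvgrPdist_le/(_ e e0)[n _ /(_ n (leqnn n)) /= ln] := fl.
rewrite -(subrK (series_from M f z n) l); apply: le_trans (ler_normD _ _) _.
exact: lerD.
Qed.

(** The sum of the nonnegative constants dominates each of them; in the partially ordered [C] it
    takes the place of a maximum. *)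
Lemma uniform_bound (I : finType) (S : I -> C -> Prop) :
  (forall i K K', K <= K' -> S i K -> S i K') ->
  (forall i, exists2 K, 0 <= K & S i K) ->
  exists2 K, 0 <= K & forall i, S i K.
Proof.
move=> mono ex.
have /choice[K HK] : forall i, exists K, 0 <= K /\ S i K.
  by move=> i; have [K] := ex i; exists K.
exists (\sum_i K i); first by apply: sumr_ge0 => i _; case: (HK i).
move=> i; apply: mono (HK i).2; rewrite (bigD1 i) //= lerDl.
by apply: sumr_ge0 => j _; case: (HK j).
Qed.

Lemma mx_trunc_eval_bounded (N : nat) m p (P : 'M[laurent C]_(m, p)) :
  exists2 K : C, 0 <= K &
    forall z, `|z| <= 1 -> forall i j, `|map_mx (trunc_eval N z) P i j| <= K.
Proof.
have [|[i j]|K K0 HK] := @uniform_bound ('I_m * 'I_p)%type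
  (fun ij K => forall z, `|z| <= 1 -> `|trunc_eval N z (P ij.1 ij.2)| <= K).
- by move=> ij K K' KK' HK z z1; apply: le_trans (HK z z1) KK'.
- exact: trunc_eval_bounded.
- by exists K => // z z1 i j; rewrite mxE; exact: (HK (i, j)).
Qed.

Lemma mx_sums_bound m p (M : int) (A : 'M[laurent C]_(m, p)) (w : C) A0 :
  w != 0 -> mx_vanishes_below M A -> mx_sums A w A0 ->
  exists2 K : C, 0 <= K &
    forall z B, 0 < `|z| -> 2 * `|z| <= `|w| -> mx_sums A z B ->
      forall i j, `|B i j| <= K * `|z| ^ M.
Proof.
move=> w0 AM Aw.
have [|[i j]|K K0 HK] := @uniform_bound ('I_m * 'I_p)%type
  (fun ij K => forall z l, 0 < `|z| -> 2 * `|z| <= `|w| ->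
     laurent_sums (A ij.1 ij.2) z l -> `|l| <= K * `|z| ^ M).
- move=> ij K K' KK' HK z l z0 zw zl; apply: le_trans (HK z l z0 zw zl) _.
  by rewrite ler_wpM2r // exprz_ge0.
- exact: laurent_sums_bound (Aw i j).
- exists K => // z B z0 zw zB i j.
  exact: (HK (i, j) z _ z0 zw (zB i j)).
Qed.

End LaurentSums.

(** * Asymptotics of the singular values *)

Section SingularValuesAtZero.
Variable R : realType.
Local Notation C := R[i].
Local Open Scope complex_scope.

(** At [z], [A] is a product of bounded truncations around [B], plus a remainder of order [N + e];
    [gram_eigenvalues_le] then applies. The fixed point [w] of convergence makes [K] independent of
    [z]. The lemma serves for [A = P T Q] and for [T = P^-1 A Q^-1]. *)
Lemma gram_laurent_le n (N : nat) (e : int) (A B P Q : 'M[laurent C]_n)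
    (w : C) (A1 B1 : 'M[C]_n) :
  P \is a mxOver (@power_series C) -> Q \is a mxOver (@power_series C) ->
  mx_vanishes_below e B -> A = P *m B *m Q ->
  w != 0 -> mx_sums A w A1 -> mx_sums B w B1 ->
  exists2 K : C, 0 <= K &
    forall z A0 B0 a b, 0 < `|z| -> `|z| <= 1 -> 2 * `|z| <= `|w| ->
      mx_sums A z A0 -> mx_sums B z B0 ->
      gram_eigenvalues A0 a -> gram_eigenvalues B0 b ->
      {homo a : i j / (i <= j)%N >-> i <= j} ->
      {homo b : i j / (i <= j)%N >-> i <= j} ->
      forall i, a i <= K * (b i + (`|z| ^ (N%:Z + e)) ^+ 2).
Proof.
move=> PS QS Be AE w0 Aw Bw.
have [KP KP0 HP] := mx_trunc_eval_bounded N P.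
have [KQ KQ0 HQ] := mx_trunc_eval_bounded N Q.
have sumsF z A0 B0 : z != 0 -> mx_sums A z A0 -> mx_sums B z B0 ->
    mx_sums (A - map_mx (ltrunc N) P *m B *m map_mx (ltrunc N) Q) z
      (A0 - map_mx (trunc_eval N z) P *m B0 *m map_mx (trunc_eval N z) Q).
  move=> z0 zA zB.
  exact: (mx_sumsB z0 zA (mx_sums_truncMr N Q z0 (mx_sums_truncMl N P z0 zB))).
have := mx_trunc_mul (N := N) PS QS Be; rewrite -AE => Fv.
have [KF KF0 HF] := mx_sums_bound w0 Fv (sumsF _ _ _ w0 Aw Bw).
pose k (x : C) := n%:R ^+ 3 * x ^+ 2.
have k0 x : 0 <= x -> 0 <= k x by move=> x0; rewrite mulr_ge0 ?exprn_ge0.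
exists (2 * (k KP * k KQ) + 2 * k KF).
  by rewrite addr_ge0 // !mulr_ge0 ?k0.
move=> z A0 B0 a b z0 z1 zw zA zB ga gb amono bmono i.
have zn0 : z != 0 by rewrite -normr_gt0.
set X := map_mx (trunc_eval N z) P; set Y := map_mx (trunc_eval N z) Q.
have FE : A0 = X *m B0 *m Y + (A0 - X *m B0 *m Y) by rewrite addrC subrK.
have b0 := gram_eigenvalues_ge0 i gb.
have z20 : 0 <= (`|z| ^ (N%:Z + e)) ^+ 2 by rewrite exprn_ge0 // exprz_ge0.
apply: le_trans
  (gram_eigenvalues_le ga gb amono bmono (k0 _ KP0) (k0 _ KQ0) _ _ _ FE i) _.
- by move=> u; apply: sqnorm_mulmx_le; exact: HP.
- by move=> u; apply: sqnorm_mulmx_le; exact: HQ.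
- by move=> u; apply: sqnorm_mulmx_le; exact: HF z _ z0 zw (sumsF _ _ _ zn0 zA zB).
have sums_le (p q s t : C) : 0 <= p -> 0 <= q -> 0 <= s -> 0 <= t ->
    2 * (p * s) + 2 * (q * t) <= (2 * p + 2 * q) * (s + t).
  move=> p0 q0 s0 t0.
  have -> : (2 * p + 2 * q) * (s + t) =
            2 * (p * s) + 2 * (q * t) + 2 * (p * t + q * s) by ring.
  by rewrite lerDl mulr_ge0 // addr_ge0 // mulr_ge0.
have -> : n%:R ^+ 3 * (KF * `|z| ^ (N%:Z + e)) ^+ 2 =
          k KF * (`|z| ^ (N%:Z + e)) ^+ 2 by rewrite /k exprMn mulrA.
have kPQ0 : 0 <= k KP * k KQ by apply: mulr_ge0; exact: k0.
exact: sums_le kPQ0 (k0 _ KF0) b0 z20.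
Qed.

(** * From sorted singular values to ordered eigenvalues of [B B^*] *)

Section Gram.
Local Open Scope sesquilinear_scope.

Lemma gram_diag n (d : 'rV[C]_n) :
  gram_eigenvalues (diag_mx d) (fun i => `|d 0 i| ^+ 2).
Proof.
exists 1%:M; first by apply/unitarymxP; rewrite trmx1 map_mx1 mulmx1.
rewrite trmx1 map_mx1 mulmx1 mul1mx tr_diag_mx map_diag_mx mulmx_diag.
by congr diag_mx; apply/rowP => i; rewrite !mxE normCK.
Qed.

Lemma complex_ge0E (x : C) :
  0 <= x -> x = (complex.Re x)%:C /\ 0 <= complex.Re x.
Proof. by case: x => a b; rewrite lecE /= => /andP[/eqP -> ?]. Qed.

(** The list [eigenvalues] and the spectral [l] are roots of one polynomial, hence agree up to
    order. The permutation that sorts the square roots also orders [l], since the square root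
    reflects the order on nonnegative reals. *)
Lemma singular_values_gram n (B : 'M[C]_n) :
  exists e : 'I_n -> R,
    [/\ gram_eigenvalues B (fun i => (e i)%:C),
        {homo e : i j / (i <= j)%N >-> i <= j}
      & forall i : 'I_n, nth 0 (singular_values B) i = Num.sqrt (e i)].
Proof.
have [l lB pB] := gram_spectral B.
pose g (z : C) := Num.sqrt (complex.Re z).
have rootsE : perm_eq (eigenvalues (B *m B^t*)) [tuple l i | i < n].
  apply/prod_XsubC_eq; rewrite /eigenvalues; case: closed_field_poly_normal => r /=.
  rewrite (monicP (char_poly_monic _)) scale1r pB => <-.
  by rewrite big_image.
have : perm_eq (singular_values B) [tuple g (l i) | i < n].
  rewrite /singular_values perm_sort.
  have -> : [tuple g (l i) | i < n] = map g [tuple l i | i < n] :> seq R.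
    by rewrite /= -map_comp.
  exact: perm_map.
case/tuple_permP => s sE; pose e i := complex.Re (l (s i)).
have lE i : l i = (complex.Re (l i))%:C /\ 0 <= complex.Re (l i).
  by apply/complex_ge0E/(gram_eigenvalues_ge0 i lB).
have nthE (i : 'I_n) : nth 0 (singular_values B) i = Num.sqrt (e i).
  by rewrite sE -tnth_nth !tnth_mktuple.
exists e; split; [|move=> i j ij|exact: nthE].
  have -> : (fun i => (e i)%:C) = l \o s by apply/funext => i; rewrite /= -(lE _).1.
  exact: gram_eigenvalues_perm.
rewrite -ler_sqrt ?(lE _).2 // -!nthE.
have sz : size (singular_values B) = n by rewrite sE size_tuple.
apply: sorted_leq_nth => //; rewrite ?inE ?sz //.
  by apply: le_trans.
by apply: sort_sorted; exact: le_total.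
Qed.

End Gram.

(** * Two-sided estimate of the eigenvalues by powers of [t] *)

Lemma ler_exprz_le1 (x : R) (m k : int) :
  0 < x -> x <= 1 -> m <= k -> x ^ k <= x ^ m.
Proof.
move=> x0 x1 mk; rewrite -[k]opprK -[m]opprK -!(exprz_inv x).
by apply: ler_weXz2l; rewrite ?lerN2 // invf_ge1.
Qed.

Lemma ln_exprz (x : R) (k : int) : 0 < x -> ln (x ^ k) = k%:~R * ln x.
Proof. by move=> x0; rewrite -powR_intmul ?ln_powR // ltW. Qed.

(** Since [t * K2 < 1 / 2], the error [K2 * q] is at most [b / 2] and moves to the left, giving
    [b <= 2 * K2 * a]; [q <= b] alone gives [a <= 2 * K1 * b]. One constant covers both. *)
Lemma absorb_error (a b q t K1 K2 : R) :
  0 <= t -> 0 <= K1 -> 0 <= K2 -> 0 <= a -> 0 <= b ->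
  t * (2 * K2 + 2) < 1 -> q <= b -> q <= t * b ->
  a <= K1 * (b + q) -> b <= K2 * (a + q) ->
  b <= (2 * K1 + 2 * K2 + 1) * a /\ a <= (2 * K1 + 2 * K2 + 1) * b.
Proof.
move=> t0 K10 K20 a0 b0 tK qb qtb aK bK.
have K1a := mulr_ge0 K10 a0; have K2b := mulr_ge0 K20 b0.
split.
  have h1 : K2 * q <= K2 * (t * b) by rewrite ler_wpM2l.
  have h2 : (t * (2 * K2 + 2)) * b <= 1 * b by rewrite ler_wpM2r // ltW.
  have h3 := mulr_ge0 t0 b0; lra.
have h1 : K1 * q <= K1 * b by rewrite ler_wpM2l.
lra.
Qed.

Lemma norm_realc (t : R) : 0 <= t -> `|t%:C| = t%:C.
Proof. by move=> t0; rewrite ger0_norm // ler0c. Qed.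

Lemma realc_exprz (t : R) (k : int) : 0 < t -> t%:C ^ k = (t ^ k)%:C.
Proof. by move=> t0; rewrite -rmorphXz // unitfE gt_eqF. Qed.

Lemma gram_laurent_estimate (n : nat) (A : 'M[laurent C]_n) (v : 'I_n -> int)
    (eps : R) :
  0 < eps ->
  (forall z : C, 0 < `|z| < eps%:C ->
     forall i j : 'I_n, laurent_converges (A i j) z) ->
  invariant_factors A v ->
  exists2 K : R, 0 < K & exists2 t0 : R, 0 < t0 <= 1 &
    forall (t : R) (a : 'I_n -> R), 0 < t < t0 ->
      gram_eigenvalues (laurent_mx_eval A t%:C) (fun i => (a i)%:C) ->
      {homo a : i j / (i <= j)%N >-> i <= j} ->
      forall i, (t ^ v i) ^+ 2 <= K * a i /\ a i <= K * (t ^ v i) ^+ 2.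
Proof.
move=> eps0 Acv [vmono [P [Q [[PS Pu PiS] [QS Qu QiS] AE]]]].
pose T := diag_mx (\row_i (laurent_var C ^ v i)).
(* [T] and [A] start at order at least [-V], so truncating at [2V + 1] leaves a remainder of order
   [V + 1], beyond every [v i]. *)
pose V := \max_i `|v i|%N.
have vV i : (`|v i| <= V)%N by exact: (@leq_bigmax _ (fun i => `|v i|%N) i).
have VE : V.*2.+1%:Z + - V%:Z = V.+1 by clear; lia.
have vV1 i : 1 + v i <= V.+1 by have := vV i; lia.
have Tv : mx_vanishes_below (- V%:Z) T.
  move=> i j k kV; rewrite !mxE; case: eqP => _ //.
  rewrite mulr1n laurent_var_exp /= ifF //; apply/eqP => ki; have := vV i; lia.
have S0 (B : 'M[laurent C]_n) :
    B \is a mxOver (@power_series C) -> mx_vanishes_below 0 B.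
  by move=> BS i j; apply/asboolP; exact: (mxOverP BS).
have Av : mx_vanishes_below (- V%:Z) A.
  rewrite AE -[- V%:Z]addr0 -[- V%:Z]add0r.
  exact: mx_vanishes_belowM (mx_vanishes_belowM (S0 _ PS) Tv) (S0 _ QS).
have TE : T = invmx P *m A *m invmx Q.
  by rewrite AE !mulmxA mulVmx // mul1mx mulmxK.
have Asums z : 0 < `|z| < eps%:C -> mx_sums A z (laurent_mx_eval A z).
  by move=> zeps i j; rewrite mxE; apply: laurent_sums_eval; exact: Acv.
pose w : C := (eps / 2)%:C.
have e20 : 0 < eps / 2 by rewrite divr_gt0.
have wN : `|w| = w by rewrite norm_realc // ltW.
have w0 : w != 0 by rewrite -normr_gt0 wN ltcR.
have weps : 0 < `|w| < eps%:C by rewrite wN !ltcR e20 /=; lra.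
have Tw := @mx_sums_diag _ _ v _ w0.
have [k1 k10 H1] := gram_laurent_le (V.*2.+1) PS QS Tv AE w0 (Asums w weps) Tw.
have [k2 k20 H2] := gram_laurent_le (V.*2.+1) PiS QiS Av TE w0 Tw (Asums w weps).
rewrite VE in H1 H2.
have [] := complex_ge0E k10; set K1 := complex.Re k1 => k1E K10.
have [] := complex_ge0E k20; set K2 := complex.Re k2 => k2E K20.
exists (2 * K1 + 2 * K2 + 1); first by rewrite ltr_wpDl // addr_ge0 // mulr_ge0.
(* The bound 1 keeps [z] in the unit disc, [eps / 4] gives [2 |z| <= |w|] for [|w| = eps / 2], and
   the last term is the smallness required by [absorb_error]. *)
exists (Num.min (Num.min 1 (eps / 4)) (1 / (2 * K2 + 2))).
  by rewrite !lt_min !ge_min lexx ltr01 !divr_gt0 // ltr_wpDl // mulr_ge0.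
move=> t a /andP[t0]; rewrite !lt_min => /andP[/andP[t1 teps] tK2] ga amono i.
have K2p : 0 < 2 * K2 + 2 by rewrite ltr_wpDl // mulr_ge0.
have {}tK2 : t * (2 * K2 + 2) < 1 by rewrite ltr_pdivlMr // in tK2.
pose z : C := t%:C.
have zN : `|z| = z by rewrite norm_realc // ltW.
have z0 : 0 < `|z| by rewrite zN ltcR.
have z1 : `|z| <= 1 by rewrite zN lecR ltW.
have zw : 2 * `|z| <= `|w|.
  rewrite zN wN -(rmorph_nat (real_complex R)) -rmorphM lecR.
  by move: teps; clear; lra.
have zeps : 0 < `|z| < eps%:C
  by rewrite z0 zN ltcR /=; move: eps0 teps; clear; lra.
have zn0 : z != 0 by rewrite -normr_gt0.
have Tz := @mx_sums_diag _ _ v _ zn0.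
pose b j : R := (t ^ v j) ^+ 2.
have gb : gram_eigenvalues (diag_mx (\row_j z ^ v j)) (fun j => (b j)%:C).
  have := gram_diag (\row_j z ^ v j); congr gram_eigenvalues; apply/funext => j.
  by rewrite mxE norm_exprz zN realc_exprz // -rmorphXn.
have tv0 j : 0 < t ^ v j by exact: exprz_gt0.
have bmono : {homo b : j k / (j <= k)%N >-> j <= k}.
  move=> j k jk; rewrite ler_sqr ?nnegrE ?(ltW (tv0 _)) //.
  by apply: ler_exprz_le1 => //; [exact: ltW|exact: vmono].
have toC (f : 'I_n -> R) : {homo f : j k / (j <= k)%N >-> j <= k} ->
    {homo (fun j => (f j)%:C) : j k / (j <= k)%N >-> j <= k}.
  by move=> fm j k jk; rewrite lecR fm.
have {H1} := H1 z _ _ _ _ z0 z1 zw (Asums z zeps) Tz ga gb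
  (toC _ amono) (toC _ bmono) i.
have {H2} := H2 z _ _ _ _ z0 z1 zw Tz (Asums z zeps) gb ga
  (toC _ bmono) (toC _ amono) i.
rewrite k1E k2E zN realc_exprz // -!rmorphXn -!rmorphD -!rmorphM !lecR.
set q := (t ^ V.+1) ^+ 2 => H2 H1.
have b0 : 0 < b i by rewrite exprn_gt0.
(* Since [1 + v i <= V + 1], [q] is at most [t^2 * b i], and [t^2 <= t]. *)
have qb : q <= t * b i.
  have tV : t ^ V.+1 <= t * t ^ v i.
    rewrite -[X in X * _]expr1z -expfzDr ?gt_eqF //.
    by apply: ler_exprz_le1 => //; exact: ltW.
  have tt : t ^+ 2 <= t by rewrite expr2 ler_piMr // ltW.
  apply: (@le_trans _ _ ((t * t ^ v i) ^+ 2)).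
    by rewrite ler_sqr ?nnegrE ?mulr_ge0 ?exprz_ge0 // ltW.
  by rewrite exprMn ler_wpM2r // ltW.
have q1 : q <= b i by apply: le_trans qb _; rewrite ler_piMl // ltW.
have a0 : 0 <= a i by have := gram_eigenvalues_ge0 i ga; rewrite ler0c.
exact: absorb_error (ltW t0) K10 K20 a0 (ltW b0) tK2 q1 qb H1 H2.
Qed.

End SingularValuesAtZero.

(** * Passage to logarithms *)

Theorem theorem1p1 (R : realType) (n : nat) (A : 'M[laurent R[i]]_n)
    (v : 'I_n -> int) :
  (0 < n)%N ->
  A \in unitmx ->
  (exists eps : R, 0 < eps /\
     forall z : R[i], 0 < `|z| < eps%:C ->
       forall i j : 'I_n, laurent_converges (A i j) z) ->
  invariant_factors A v ->
  (\row_(i < n)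
     logb t (nth 0 (singular_values (laurent_mx_eval A t%:C)) i))
    @[t --> 0^'+] --> \row_(i < n) ((v i)%:~R : R).
Proof.
move=> _ _ [eps [eps0 Acv]] Av.
have [K K0 [t0 /andP[t00 t01] HK]] := gram_laurent_estimate eps0 Acv Av.
(* Taking logarithms of the two-sided bound on squares leaves an error independent of [t], which
   division by [ln t] sends to 0. *)
have est (t : R) (i : 'I_n) : 0 < t < t0 ->
    `|(v i)%:~R * ln t - ln (nth 0 (singular_values (laurent_mx_eval A t%:C)) i)|
      <= `|ln K|.
  move=> tt0; have [a [ga amono ->]] := singular_values_gram (laurent_mx_eval A t%:C).
  have [lo up] := HK t a tt0 ga amono i; case/andP: tt0 => t_gt0 _.
  have b0 : 0 < (t ^ v i) ^+ 2 by rewrite exprn_gt0 // exprz_gt0.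
  have a0 : 0 < a i by rewrite -(pmulr_rgt0 _ K0); exact: lt_le_trans lo.
  have Ka0 := mulr_gt0 K0 a0; have Kb0 := mulr_gt0 K0 b0.
  have : ln ((t ^ v i) ^+ 2) <= ln (K * a i) by rewrite ler_ln ?posrE.
  have : ln (a i) <= ln (K * (t ^ v i) ^+ 2) by rewrite ler_ln ?posrE.
  have aE : ln (a i) = ln (Num.sqrt (a i)) *+ 2.
    by rewrite -lnXn ?sqrtr_gt0 // sqr_sqrtr // ltW.
  have lnK x : 0 < x -> ln (K * x) = ln K + ln x by move=> x0; rewrite lnM ?posrE.
  rewrite !lnK // aE lnXn ?exprz_gt0 // ln_exprz // !mulr2n => h1 h2.
  have := ler_norm (ln K); have := ler_norm (- ln K); rewrite normrN => h3 h4.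
  by rewrite ler_norml; lra.
apply/cvg_ballP => e e0.
(* Below this threshold [- ln t * e] exceeds [|ln K| + 1]; the added 1 keeps the quotient positive,
   so that [ln t < 0]. *)
pose t1 := Num.min t0 (expR (- ((`|ln K| + 1) / e))).
have t10 : 0 < t1 by rewrite lt_min t00 expR_gt0.
near=> t.
have t_gt0 : 0 < t by [].
have : t < t1 by near: t; exact: nbhs_right_lt.
rewrite lt_min => /andP[tt0 te].
have lnt : ln t < - ((`|ln K| + 1) / e).
  by rewrite -[ltRHS]expRK ltr_ln ?posrE ?expR_gt0.
have lnt0 : ln t < 0.
  by apply: lt_trans lnt _; rewrite oppr_lt0 divr_gt0 // ltr_wpDl.
split=> // i j; rewrite !mxE /ball /= /logb.
have {1}-> : (v j)%:~R = (v j)%:~R * ln t / ln t :> R by rewrite mulfK // lt_eqF.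
rewrite -mulrBl normrM normfV (ltr0_norm lnt0) ltr_pdivrMr ?oppr_gt0 //.
apply: le_lt_trans (est t j _) _; first by rewrite t_gt0.
have : (`|ln K| + 1) / e * e < - ln t * e by rewrite ltr_pM2r // ltrNr.
by rewrite divfK ?gt_eqF // mulrC; lra.
Unshelve. all: by end_near.
Qed.
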